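(* Let $G$ be a simple $k$-regular graph with $n \geqslant 2$ vertices, let $m$ be a positive integer, and let $Spl_m(G)$ be the $m$-splitting graph of $G$. Then (1) $SO(G)=\frac{nk^2}{\sqrt{2}}$, and (2) $SO(Spl_{m}(G))=SO(G)\left(m\sqrt{2m^2+4m+4}+(m+1)\right)$.
   Context: For a simple graph $H$, $d_H(u)$ denotes the degree of vertex $u$ and $E(H)$ the edge set. The Sombor index is $SO(H)=\sum_{uv\in E(H)}\sqrt{d_H(u)^2+d_H(v)^2}$. The $m$-splitting graph $Spl_m(G)$ of a graph $G$ with vertices $v_1,\dots,v_n$ is obtained by adding, for each vertex $v_i$, $m$ new vertices $v_{i1},\dots,v_{im}$, where each $v_{ij}$ ($1\le i\le n$, $1\le j\le m$) is made adjacent to every vertex that is adjacent to $v_i$ in $G$ (and to no other vertices). *)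

(* Defs.v *)
From mathcomp Require Import all_boot all_order all_algebra.

Set Implicit Arguments.
Unset Strict Implicit.
Unset Printing Implicit Defensive.

Import Order.TTheory GRing.Theory Num.Theory.

Record sgraph := SGraph {
  vertex :> finType;
  adj : rel vertex;
  adj_sym : symmetric adj;
  adj_irr : irreflexive adj
}.

Definition neighbours (G : sgraph) (u : G) : {set G} := [set v | adj u v].

Definition degree (G : sgraph) (u : G) : nat := #|neighbours u|.

(* Edges are two-element vertex sets, so each edge is counted once. *)
Definition edges (G : sgraph) : {set {set G}} :=
  [set [set u; v] | u in G, v in neighbours u].

Definition regular (G : sgraph) (k : nat) : Prop := forall u : G, degree u = k.

(* For an edge e = {u, v}, the inner sum is d(u)^2 + d(v)^2. *)
Definition sombor (R : rcfType) (G : sgraph) : R :=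
  (\sum_(e in edges G) Num.sqrt (\sum_(u in e) (degree u)%:R ^+ 2))%R.

(* inl v is the original vertex v; inr (v, j) is its j-th added copy. *)
Definition splitting_adj (m : nat) (G : sgraph) : rel (G + G * 'I_m) :=
  fun x y =>
    match x, y with
    | inl u, inl v => adj u v
    | inl u, inr (v, _) => adj v u
    | inr (u, _), inl v => adj u v
    | inr _, inr _ => false
    end.

Lemma splitting_adj_sym (m : nat) (G : sgraph) : symmetric (@splitting_adj m G).
Proof. by move=> [u|[u i]] [v|[v j]] //=; rewrite adj_sym. Qed.

Lemma splitting_adj_irr (m : nat) (G : sgraph) :
  irreflexive (@splitting_adj m G).
Proof. by move=> [u|[u i]] //=; rewrite adj_irr. Qed.

Definition splitting (m : nat) (G : sgraph) : sgraph :=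
  SGraph (@splitting_adj_sym m G) (@splitting_adj_irr m G).

(* Main.v *)
(** Summing over ordered pairs of adjacent vertices counts every edge twice. In
    [splitting m G] an original vertex has degree [(m + 1) k], a copy has degree
    [k], and each ordered pair [(u, v)] of adjacent vertices of [G] gives one
    pair of originals and, for each of the [m] copy indices, one pair
    (original, copy) and one pair (copy, original). *)
Require Import Defs.
From mathcomp Require Import all_boot all_order all_algebra.
From mathcomp Require Import ring.

Import Order.TTheory GRing.Theory Num.Theory.
Local Open Scope ring_scope.

(** The map sending an ordered adjacent pair to its underlying set has fibres of size exactly two
    over the edges. Doubling the left side, rather than halving the right, avoids division, so any
    [nmodType] will do. *)
Lemma big_edges2 (V : nmodType) (G : sgraph) (F : {set G} -> V) :
  (\sum_(e in edges G) F e) *+ 2 = \sum_(u : G) \sum_(v | adj u v) F [set u; v].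
Proof.
rewrite pair_big_dep /= -sumrMnl.
rewrite (partition_big (fun p : G * G => [set p.1; p.2])
                       (mem (edges G))) /=; last first.
  by move=> [u v] /= uv; apply/imset2P; exists u v; rewrite ?inE.
apply: eq_bigr => _ /imset2P[u v _ /[!inE] uv ->].
have neq_uv : u != v by apply: contraTneq uv => ->; rewrite adj_irr.
rewrite (eq_bigr (fun=> F [set u; v])); last by move=> p /andP[_ /eqP ->].
rewrite sumr_const; congr (_ *+ _).
(* The fibre over the edge consists of its two orderings, which differ because [u != v]. *)
rewrite (eq_card (B := [set (u, v); (v, u)])) ?cards2 ?xpair_eqE ?negb_and
        ?neq_uv //.
move=> [a b]; rewrite !inE !xpair_eqE /= unfold_in /=.
apply/andP/orP => [[ab /eqP eq_ab] | [] /andP[/eqP -> /eqP ->]]; last 2 first.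
- by rewrite eqxx.
- by rewrite adj_sym setUC eqxx.
(* Both [a] and [b] lie in [[set u; v]]; being distinct, they can only be [u] and [v] in one of the
   two orders. *)
have neq_ab : a != b by apply: contraTneq ab => ->; rewrite adj_irr.
have : a \in [set u; v] by rewrite -eq_ab set21.
have : b \in [set u; v] by rewrite -eq_ab set22.
by rewrite !inE => /orP[] /eqP eb /orP[] /eqP ea;
  move: neq_ab; rewrite ea eb !eqxx //; [right | left].
Qed.

Lemma sombor_mul2 (R : rcfType) (G : sgraph) :
  sombor R G *+ 2 =
  \sum_(u : G) \sum_(v | adj u v)
     Num.sqrt ((degree u)%:R ^+ 2 + (degree v)%:R ^+ 2).
Proof.
rewrite /sombor big_edges2; apply: eq_bigr => u _; apply: eq_bigr => v uv.
have neq_uv : u != v by apply: contraTneq uv => ->; rewrite adj_irr.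
by rewrite big_setU1 ?big_set1 // inE.
Qed.

Lemma degreeE (G : sgraph) (u : G) : degree u = (\sum_(v | adj u v) 1)%N.
Proof. by rewrite sum1_card /degree cardsE. Qed.

Lemma regular_sum_adj (V : nmodType) (G : sgraph) (k : nat) (c : V) :
  regular G k -> \sum_(u : G) \sum_(v | adj u v) c = c *+ (#|G| * k).
Proof.
move=> hk; rewrite mulnC mulrnA -sumr_const; apply: eq_bigr => u _.
by rewrite sumr_const -(hk u) /degree cardsE.
Qed.

(** The codomain is left general because the lemma serves twice: with natural-number summands for
    degrees, and with square roots for the index. *)
Lemma big_splitting_inl (V : nmodType) (G : sgraph) (m : nat) (u : G)
    (F : splitting m G -> V) :
  \sum_(y | @adj (splitting m G) (inl u) y) F y =
  \sum_(v | adj u v) (F (inl v) + \sum_(j < m) F (inr (v, j))).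
Proof.
rewrite big_sumType /= big_split /=; congr (_ + _).
rewrite pair_big_dep /=; apply: eq_big => [[v j]|[v j] _] //=.
by rewrite andbT adj_sym.
Qed.

Lemma big_splitting_inr (V : nmodType) (G : sgraph) (m : nat) (p : G * 'I_m)
    (F : splitting m G -> V) :
  \sum_(y | @adj (splitting m G) (inr p) y) F y = \sum_(v | adj p.1 v) F (inl v).
Proof.
(* Two copies are never adjacent, so the sum over [inr] vertices is empty. *)
by case: p => u i; rewrite big_sumType /= [X in _ + X]big_pred0 ?addr0.
Qed.

Lemma degree_splitting_inl (G : sgraph) (m : nat) (u : G) :
  @degree (splitting m G) (inl u) = (m.+1 * degree u)%N.
Proof.
rewrite !degreeE big_splitting_inl big_distrr /=; apply: eq_bigr => v _.
by rewrite sum1_card card_ord muln1.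
Qed.

Lemma degree_splitting_inr (G : sgraph) (m : nat) (p : G * 'I_m) :
  @degree (splitting m G) (inr p) = degree p.1.
Proof. by rewrite !degreeE big_splitting_inr. Qed.

Lemma sombor_regular (R : rcfType) (G : sgraph) (k : nat) :
  regular G k -> sombor R G *+ 2 = Num.sqrt 2 * k%:R *+ (#|G| * k).
Proof.
move=> hk; rewrite sombor_mul2 -(regular_sum_adj _ _ _ _ hk).
apply: eq_bigr => u _; apply: eq_bigr => v _; rewrite !hk.
rewrite -[_ + _]mulr2n -[_ ^+ 2 *+ 2]mulr_natl sqrtrM ?ler0n //.
by rewrite sqrtr_sqr ger0_norm ?ler0n.
Qed.

Lemma sombor_splitting_regular (R : rcfType) (G : sgraph) (k m : nat) :
  regular G k ->
  sombor R (splitting m G) *+ 2 =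
  (Num.sqrt 2 * (m.+1%:R * k%:R)
     + Num.sqrt (m.+1%:R ^+ 2 + 1) * k%:R *+ m *+ 2) *+ (#|G| * k).
Proof.
move=> hk; set s2 := Num.sqrt 2; set s := Num.sqrt (_ + 1).
have sqrtE : Num.sqrt ((m.+1%:R * k%:R) ^+ 2 + k%:R ^+ 2) = s * k%:R :> R.
  rewrite (_ : _ + _ = (m.+1%:R ^+ 2 + 1) * k%:R ^+ 2); last by ring.
  by rewrite sqrtrM ?addr_ge0 ?sqr_ge0 // sqrtr_sqr ger0_norm ?ler0n.
have inl_inl : Num.sqrt ((m.+1%:R * k%:R) ^+ 2 + (m.+1%:R * k%:R) ^+ 2) =
    s2 * (m.+1%:R * k%:R) :> R.
  rewrite -[_ + _]mulr2n -[_ ^+ 2 *+ 2]mulr_natl sqrtrM ?ler0n //.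
  by rewrite sqrtr_sqr ger0_norm // mulr_ge0 ?ler0n.
(* Of the two equal mixed terms, one stays with the pairs starting at an original vertex, the other
   accounts for the pairs starting at a copy. *)
rewrite sombor_mul2 big_sumType /= mulr2n addrA mulrnDl.
congr (_ + _).
  rewrite -(regular_sum_adj _ _ _ _ hk); apply: eq_bigr => u _.
  rewrite big_splitting_inl; apply: eq_bigr => v _.
  rewrite !degree_splitting_inl !hk natrM inl_inl; congr (_ + _).
  rewrite (eq_bigr (fun=> s * k%:R)) ?sumr_const ?card_ord // => j _.
  by rewrite degree_splitting_inr hk sqrtE.
rewrite (eq_bigr (fun p => \sum_(v | adj p.1 v) s * k%:R)) => [|p _]; last first.
  rewrite big_splitting_inr; apply: eq_bigr => v _.
  by rewrite degree_splitting_inl degree_splitting_inr !hk natrM addrC sqrtE.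
(* The summand no longer depends on the copy index, so summing over that index only contributes a
   factor [m]. *)
rewrite -(pair_bigA _ (fun u (_ : 'I_m) => \sum_(v | adj u v) s * k%:R)) /=.
rewrite -(regular_sum_adj _ _ _ _ hk); apply: eq_bigr => u _.
by rewrite sumr_const card_ord sumrMnl.
Qed.

Theorem theorem1 (R : rcfType) (G : sgraph) (n k m : nat)
    (hn : #|G| = n) (hn2 : (2 <= n)%N) (hk : regular G k) (hm : (0 < m)%N) :
  sombor R G = n%:R * k%:R ^+ 2 / Num.sqrt 2 /\
  sombor R (splitting m G) =
    sombor R G *
      (m%:R * Num.sqrt (2 * m%:R ^+ 2 + 4 * m%:R + 4) + (m%:R + 1)).
Proof.
have two_neq0 : 2 != 0 :> R by rewrite pnatr_eq0.
have s2_neq0 : Num.sqrt 2 != 0 :> R by rewrite gt_eqF // sqrtr_gt0 ltr0n.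
have s2_sqr : Num.sqrt 2 ^+ 2 = 2 :> R by rewrite sqr_sqrtr ?ler0n.
have SOG : sombor R G = n%:R * k%:R ^+ 2 / Num.sqrt 2.
  apply: (mulIf two_neq0); rewrite mulr_natr (sombor_regular _ _ _ hk) hn.
  rewrite -mulr_natr natrM; move: s2_neq0 s2_sqr; set s2 := Num.sqrt 2.
  (* Writing the scalar 2 as [s2 ^+ 2] leaves an identity of rational functions in [s2]. *)
  by move=> s2_neq0 <-; field.
split=> //; apply: (mulIf two_neq0).
rewrite [LHS]mulr_natr (sombor_splitting_regular _ _ _ _ hk) hn SOG.
(* This factorisation splits the root into [Num.sqrt 2] times the root that comes from the mixed
   edges. *)
have -> : 2 * m%:R ^+ 2 + 4 * m%:R + 4 = 2 * (m.+1%:R ^+ 2 + 1) :> R.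
  by rewrite -[m.+1%:R]natr1; ring.
rewrite sqrtrM ?ler0n //; set s := Num.sqrt (_ + 1).
rewrite -(mulr_natr _ (n * k)) -[_ *+ m *+ 2]mulr_natr -[_ *+ m]mulr_natr.
rewrite natrM -[m.+1%:R]natr1; move: s2_neq0 s2_sqr; set s2 := Num.sqrt 2.
by move=> s2_neq0 <-; field.
Qed.
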